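(* Let $G$ be a disconnected finite simple graph with at least two non-trivial components (components with more than one vertex), all of whose non-trivial components have at least three edges. (1) If all components of $G$ are isomorphic to $K_3$, then $dern(G)=1$. (2) If all components of $G$ are isomorphic to $K_{1,3}$, then $dern(G)=4$. (3) If all components of $G$ are isomorphic to $K_{1,t}$ with $t>3$, then $dern(G)=1$. (4) If the components of $G$ are of exactly two types, namely those isomorphic to $K_3$ and those isomorphic to $K_{1,3}$ (with at least one of each), then $dern(G)=2$. (5) If either (i) the non-trivial components of $G$ are all isomorphic to $K_3$ and $G$ has at least one isolated vertex, or (ii) the non-trivial components of $G$ are all isomorphic to $K_{1,3}$ and $G$ has at least one isolated vertex, then in both cases $dern(G)=4$.
   Context: All graphs are finite, simple and undirected. For an edge $e=uv$ of $G$, its degree is $d(e)=d(u)+d(v)-2$, the number of edges adjacent to $e$. An edge-card of $G$ is the (unlabelled) graph $G-e$. A degree-associated edge-card (da-ecard) is the pair $(G-e,d(e))$; the da-edeck of $G$ is the multiset of all its da-ecards. The degree-associated edge-reconstruction number $dern(G)$ is the minimum $k$ such that some multiset of $k$ da-ecards of $G$ is not contained in the da-edeck of any graph $H\not\simeq G$. $K_{1,t}$ is the star with $t$ edges. *)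

(* Defs.v *)
From HB Require Import structures.
From mathcomp Require Import all_boot.

Set Implicit Arguments.
Unset Strict Implicit.
Unset Printing Implicit Defensive.

Record sgraph := SGraph {
  vertex :> finType;
  adj : rel vertex;
  adj_sym : symmetric adj;
  adj_irr : irreflexive adj
}.

Definition giso (G H : sgraph) : bool :=
  [exists f : {ffun G -> H}, exists g : {ffun H -> G},
    [&& [forall x, g (f x) == x], [forall y, f (g y) == y]
      & [forall x, forall y, adj (f x) (f y) == adj x y]]].

Lemma gisoP (G H : sgraph) :
  reflect (exists2 f : G -> H,
             bijective f & forall x y, adj (f x) (f y) = adj x y)
          (giso G H).
Proof.
apply: (iffP existsP) => [[f /existsP[g /and3P[fK gK fE]]]|[f [g fK gK] fE]].
  exists f; first by exists g => x; apply/eqP; [apply: (forallP fK)|apply: (forallP gK)].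
  by move=> x y; apply/eqP; move/forallP: fE => /(_ x)/forallP.
exists (finfun f); apply/existsP; exists (finfun g); apply/and3P; split.
- by apply/forallP=> x; rewrite !ffunE fK.
- by apply/forallP=> x; rewrite !ffunE gK.
- by apply/forallP=> x; apply/forallP=> y; rewrite !ffunE fE.
Qed.

Definition deg (G : sgraph) (x : G) : nat := #|[set y | adj x y]|.

Definition edges (G : sgraph) : {set {set G}} :=
  [set e | [exists x, exists y, adj x y && (e == [set x; y])]].

(* For e = {u, v} this is d(u) + d(v) - 2. *)
Definition edge_deg (G : sgraph) (e : {set G}) : nat := (\sum_(x in e) deg x) - 2.

Section DeleteEdge.
Variables (G : sgraph) (e : {set G}).

Definition del_edge_rel : rel G := fun x y => adj x y && ([set x; y] != e).

Lemma del_edge_sym : symmetric del_edge_rel.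
Proof. by move=> x y; rewrite /del_edge_rel adj_sym setUC. Qed.

Lemma del_edge_irr : irreflexive del_edge_rel.
Proof. by move=> x; rewrite /del_edge_rel adj_irr. Qed.

Definition del_edge : sgraph := SGraph del_edge_sym del_edge_irr.
End DeleteEdge.

Section Induced.
Variables (G : sgraph) (A : {set G}).

Definition induced_rel : rel {x : G | x \in A} := fun x y => adj (val x) (val y).

Lemma induced_sym : symmetric induced_rel.
Proof. by move=> x y; apply: adj_sym. Qed.

Lemma induced_irr : irreflexive induced_rel.
Proof. by move=> x; apply: adj_irr. Qed.

Definition induced : sgraph := SGraph induced_sym induced_irr.
End Induced.

Definition components (G : sgraph) : {set {set G}} :=
  [set [set y | connect (@adj G) x y] | x : G].

Definition disconnected (G : sgraph) : bool := 1 < #|components G|.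

Definition nontrivial (G : sgraph) (C : {set G}) : bool := 1 < #|C|.

Definition isolated (G : sgraph) (x : G) : bool := deg x == 0.

Section Complete.
Variable n : nat.

Definition complete_rel : rel 'I_n := fun x y => x != y.

Lemma complete_sym : symmetric complete_rel.
Proof. by move=> x y; rewrite /complete_rel eq_sym. Qed.

Lemma complete_irr : irreflexive complete_rel.
Proof. by move=> x; rewrite /complete_rel eqxx. Qed.

Definition complete : sgraph := SGraph complete_sym complete_irr.
End Complete.

Section CompleteBipartite.
Variables m n : nat.

Definition biclique_rel : rel ('I_m + 'I_n)%type :=
  fun x y => is_inl x (+) is_inl y.

Lemma biclique_sym : symmetric biclique_rel.
Proof. by move=> x y; apply: addbC. Qed.

Lemma biclique_irr : irreflexive biclique_rel.
Proof. by move=> x; apply: addbb. Qed.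

Definition biclique : sgraph := SGraph biclique_sym biclique_irr.
End CompleteBipartite.

Definition star (t : nat) : sgraph := biclique 1 t.

(* Finite multisets of unlabelled graphs with a degree are represented by
   sequences of labelled ones; multiplicities are counted up to isomorphism. *)
Definition da_ecard : Type := sgraph * nat.

Definition da_ecard_eqv (c d : da_ecard) : bool :=
  giso c.1 d.1 && (c.2 == d.2).

Definition da_edeck (G : sgraph) : seq da_ecard :=
  [seq (del_edge e, edge_deg e) | e <- enum (edges G)].

Definition sub_multiset (s1 s2 : seq da_ecard) : Prop :=
  forall c : da_ecard, count (da_ecard_eqv c) s1 <= count (da_ecard_eqv c) s2.

Definition determined_by (G : sgraph) (k : nat) : Prop :=
  exists s : seq da_ecard,
    [/\ size s = k,
        sub_multiset s (da_edeck G)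
      & forall H : sgraph, ~~ giso G H -> ~ sub_multiset s (da_edeck H)].

(* [is_dern G k] means dern(G) = k; a relation, since a graph need not be
   determined by its da-edeck (e.g. edgeless graphs), so that the minimum need
   not exist. *)
Definition is_dern (G : sgraph) (k : nat) : Prop :=
  determined_by G k /\ forall j : nat, determined_by G j -> k <= j.

(* Main.v *)
Require Import Defs.
From mathcomp Require Import all_boot all_fingroup zify.

Set Implicit Arguments.
Unset Strict Implicit.
Unset Printing Implicit Defensive.

(** A graph [H] sharing the card [(G - e, d(e))] arises from [G - e] by adding
    an edge [xy] whose ends have degrees adding up to [d(e)] in [G - e].
    Comparing degrees, in cases (1) and (3) [xy] can only be [e] itself.  In
    the other cases [d(e) = 2], and the edges of [H] giving back the same card
    are confined by degrees as soon as [H] is not isomorphic to [G]: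
    - if all components are claws or isolated vertices, they join vertices of
      degree 2 of [H], of which there are three; three is attained by joining
      the two leaves of the path in [G - e], making it a triangle;
    - if all components are triangles or isolated vertices, they contain the
      only vertex of degree 3 of [H]; three is attained by joining an isolated
      vertex to the middle of the path in [G - e], making it a claw;
    - for triangles and claws together, taking [e] in a triangle, the added edge
      creates a vertex of degree 2 next to one of degree 3, which [G - e] lacks,
      so it is the only edge giving back the card.
    A single card does not suffice in the last case: one can join two leaves of
    a claw of [G], or two leaves of the claw that lost an edge. *)

(** * Isomorphisms and edge deletion *)

(** The map is kept explicit because [del_edge] and [add_edge] do not change the vertex type: one
    function can be an isomorphism of cards without being one of the graphs themselves. *)
Definition iso_fun (G H : sgraph) (f : G -> H) : Prop :=
  bijective f /\ forall x y, adj (f x) (f y) = adj x y.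

Lemma gisoI (G H : sgraph) (f : G -> H) : iso_fun f -> giso G H.
Proof. by case=> bf hf; apply/gisoP; exists f. Qed.

Lemma giso_iso_fun (G H : sgraph) : giso G H -> exists f : G -> H, iso_fun f.
Proof. by case/gisoP=> f bf hf; exists f. Qed.

Lemma giso_refl (G : sgraph) : giso G G.
Proof. by apply: (@gisoI _ _ id); split=> //; exists id. Qed.

Lemma giso_sym (G H : sgraph) : giso G H = giso H G.
Proof.
suff imp (K L : sgraph) : giso K L -> giso L K by apply/idP/idP; apply: imp.
case/giso_iso_fun=> f [[g fK gK] hf]; apply: (@gisoI _ _ g); split.
  by exists f.
by move=> x y; rewrite -hf !gK.
Qed.

Lemma iso_fun_comp (G H K : sgraph) (g : H -> K) (f : G -> H) :
  iso_fun g -> iso_fun f -> iso_fun (g \o f).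
Proof.
by move=> [bg hg] [bf hf]; split=> [|x y /=]; [apply: bij_comp | rewrite hg hf].
Qed.

Lemma giso_trans (H G K : sgraph) : giso G H -> giso H K -> giso G K.
Proof.
by move=> /giso_iso_fun[f hf] /giso_iso_fun[g hg]; exact: gisoI (iso_fun_comp hg hf).
Qed.

Lemma deg_iso_fun (G H : sgraph) (f : G -> H) (x : G) : iso_fun f -> deg (f x) = deg x.
Proof.
case=> bf hf; rewrite /deg -(card_imset _ (bij_inj bf)); apply: eq_card => y.
rewrite !inE; case: bf => g fK gK; apply/idP/imsetP=> [h|[z]].
  by exists (g y); rewrite ?inE ?gK // -hf gK.
by rewrite inE => h ->; rewrite hf.
Qed.

Lemma edgesP (G : sgraph) (e : {set G}) :
  reflect (exists x y, adj x y /\ e = [set x; y]) (e \in edges G).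
Proof.
rewrite inE; apply: (iffP existsP) => [[x /existsP[y /andP[h /eqP->]]]|[x [y [h ->]]]].
  by exists x, y.
by exists x; apply/existsP; exists y; rewrite h eqxx.
Qed.

Lemma mem_edges (G : sgraph) (x y : G) : adj x y -> [set x; y] \in edges G.
Proof. by move=> h; apply/edgesP; exists x, y. Qed.

Lemma adj_neq (G : sgraph) (x y : G) : adj x y -> x != y.
Proof. by apply: contraTneq => ->; rewrite adj_irr. Qed.

Lemma edge_at (G : sgraph) (e : {set G}) (x : G) :
  e \in edges G -> x \in e -> exists2 y, adj x y & e = [set x; y].
Proof.
case/edgesP=> a [b [h ->]]; rewrite !inE => /orP[]/eqP->; first by exists b.
by exists a; rewrite 1?adj_sym // setUC.
Qed.

Lemma set2_inj (T : finType) (x y z : T) : [set x; y] = [set x; z] -> y = z.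
Proof.
move=> h; have : y \in [set x; z] by rewrite -h !inE eqxx orbT.
rewrite !inE => /orP[/eqP yx|/eqP//]; subst y.
have : z \in [set x; x] by rewrite h !inE eqxx orbT.
by rewrite !inE orbb => /eqP.
Qed.

Lemma edge_eqE (G : sgraph) (x y u v : G) :
  adj x y -> ([set u; v] == [set x; y]) = ((u == x) && (v == y)) || ((u == y) && (v == x)).
Proof.
move=> h; apply/eqP/orP => [E|[]/andP[/eqP-> /eqP->] //]; last by rewrite setUC.
have : u \in [set x; y] by rewrite -E !inE eqxx.
rewrite !inE => /orP[]/eqP Eu; subst u; [left|right]; rewrite eqxx /=.
  by apply/eqP/(set2_inj E).
by rewrite [RHS]setUC in E; apply/eqP/(set2_inj E).
Qed.

Lemma deg_del_edge (G : sgraph) (e : {set G}) (x : G) :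
  e \in edges G -> deg x = @deg (del_edge e) x + (x \in e).
Proof.
move=> he; case: (boolP (x \in e)) => [xe|xe]; last first.
  rewrite addn0 /deg; apply: eq_card => y; rewrite !inE /= /del_edge_rel.
  case: eqP => [E|]; last by rewrite andbT.
  by case/negP: xe; rewrite -E !inE eqxx.
have [z hz E] := edge_at he xe.
have -> : deg x = #|z |: [set y | @adj (del_edge e) x y]|.
  rewrite /deg; apply: eq_card => y; rewrite !inE /= /del_edge_rel.
  case: (eqVneq y z) => [->//|nyz] /=; rewrite E.
  by case: eqP => [/set2_inj/eqP|]; rewrite ?(negPf nyz) ?andbT.
by rewrite cardsU1 inE /= /del_edge_rel E eqxx andbF addnC.
Qed.

Lemma adj_del_edge (G : sgraph) (e : {set G}) (x y : G) :
  e \in edges G -> adj x y = @adj (del_edge e) x y || ([set x; y] == e).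
Proof.
move=> he; rewrite /= /del_edge_rel; case: eqP => [E|]; rewrite ?andbT ?orbF //= orbT.
case/edgesP: he => a [b [h Eab]]; move/eqP: E; rewrite Eab edge_eqE //.
by case/orP=> /andP[/eqP-> /eqP->]; rewrite // adj_sym.
Qed.

Lemma edge_deg_set2 (G : sgraph) (x y : G) :
  adj x y -> edge_deg [set x; y] = deg x + deg y - 2.
Proof.
by move=> h; rewrite /edge_deg big_setU1 ?inE ?adj_neq //= big_set1.
Qed.

(** Each end loses one unit when the edge is deleted, which absorbs the [- 2]. Thus a da-ecard
    prescribes the degree sum, inside the card, of the two vertices to be joined. *)
Lemma edge_deg_del_edge (G : sgraph) (x y : G) : adj x y ->
  edge_deg [set x; y]
    = @deg (del_edge [set x; y]) x + @deg (del_edge [set x; y]) y.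
Proof.
move=> h; rewrite edge_deg_set2 // !(deg_del_edge _ (mem_edges h)) !inE !eqxx orbT /=.
lia.
Qed.

Lemma iso_fun_del_edge (G H : sgraph) (f : G -> H) (e : {set G}) :
  iso_fun f -> @iso_fun (del_edge e) (del_edge (f @: e)) f.
Proof.
case=> bf hf; split=> // x y; rewrite /= /del_edge_rel hf; congr (_ && ~~ _).
have -> : [set f x; f y] = f @: [set x; y] by rewrite imsetU1 imset_set1.
exact: (inj_eq (imset_inj (bij_inj bf))).
Qed.

Lemma giso_of_del_edge (G H : sgraph) (e : {set G}) (d : {set H}) (f : G -> H) :
    e \in edges G -> d \in edges H -> @iso_fun (del_edge e) (del_edge d) f ->
  f @: e = d -> giso G H.
Proof.
move=> he hd [bf hf] E; apply: (@gisoI _ _ f); split=> // x y.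
rewrite (adj_del_edge _ _ he) (adj_del_edge _ _ hd) hf; congr (_ || _).
have -> : [set f x; f y] = f @: [set x; y] by rewrite imsetU1 imset_set1.
by rewrite -E; exact: (inj_eq (imset_inj (bij_inj bf))).
Qed.

(** Twins can be exchanged. Neighbours are compared away from [u] and [v] only, so that adjacent
    twins are covered as well. *)
Lemma iso_fun_tperm (G : sgraph) (u v : G) :
    (forall z, z != u -> z != v -> adj u z = adj v z) ->
  iso_fun (tperm u v : G -> G).
Proof.
move=> tw; split; first by exists (tperm u v); apply: tpermK.
have [->|nuv] := eqVneq u v; first by move=> x y; rewrite tperm1 !perm1.
move=> x y; case: tpermP => [->|->|/eqP xu /eqP xv];
  case: tpermP => [->|->|/eqP yu /eqP yv]; rewrite ?adj_irr //.
- exact: adj_sym.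
- by rewrite tw.
- exact: adj_sym.
- by rewrite tw.
- by rewrite adj_sym -tw // adj_sym.
- by rewrite adj_sym tw // adj_sym.
Qed.

(** Meant for exchanging two components listed in corresponding orders. The default value of [nth]
    is never reached when the lists have the same length. *)
Definition swap_seq (T : eqType) (s t : seq T) (x : T) : T :=
  if x \in s then nth x t (index x s)
  else if x \in t then nth x s (index x t) else x.

Lemma swap_seqK (T : eqType) (s t : seq T) :
  uniq (s ++ t) -> size s = size t -> involutive (swap_seq s t).
Proof.
rewrite cat_uniq => /and3P[us /hasPn dst ut] sz x; rewrite {2}/swap_seq.
have dts y : y \in s -> y \notin t by move=> ys; apply/negP=> /dst/negP.
case: ifPn => xs.
  have lt : index x s < size t by rewrite -sz index_mem.
  rewrite /swap_seq (negPf (dst _ (mem_nth x lt))) (mem_nth x lt).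
  by rewrite index_uniq // (set_nth_default x) ?nth_index // sz.
case: ifPn => xt; last by rewrite /swap_seq (negPf xs) (negPf xt).
have lt : index x t < size s by rewrite sz index_mem.
rewrite /swap_seq (mem_nth x lt) index_uniq // (set_nth_default x) ?nth_index //.
by rewrite -sz.
Qed.

(** No edge leaves [s] or [t], and [R] is their common adjacency table by positions, so exchanging
    them preserves edges inside each list and creates none between a list and its outside. *)
Lemma iso_fun_swap_seq (G : sgraph) (s t : seq G) (R : rel nat) (x0 : G) :
    uniq (s ++ t) -> size s = size t ->
    {in s, forall x y, adj x y -> y \in s} ->
    {in t, forall x y, adj x y -> y \in t} ->
    (forall i j, i < size s -> j < size s -> adj (nth x0 s i) (nth x0 s j) = R i j) ->
    (forall i j, i < size t -> j < size t -> adj (nth x0 t i) (nth x0 t j) = R i j) ->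
  iso_fun (swap_seq s t).
Proof.
move=> us sz cs ct hs ht; have inv := swap_seqK us sz.
split; first by exists (swap_seq s t).
have dst y : y \in s -> y \in t -> False.
  by move: us; rewrite cat_uniq => /and3P[_ /hasPn d _] ys yt; have := d _ yt; rewrite /= ys.
have no (u : seq G) : {in u, forall x y, adj x y -> y \in u} ->
    forall x y, x \in u -> y \notin u -> adj x y = false.
  by move=> cu x y xu yu; apply/negP=> /(cu _ xu); apply/negP.
have ns x : x \in s -> x \notin t by move=> xs; apply/negP=> /(dst _ xs).
have nt x : x \in t -> x \notin s by move=> xt; apply/negP=> xs; case: (dst x).
have fs x : x \in s -> swap_seq s t x = nth x0 t (index x s).
  by move=> xs; rewrite /swap_seq xs; apply: set_nth_default; rewrite -sz index_mem.
have ft x : x \in t -> swap_seq s t x = nth x0 s (index x t).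
  move=> xt; rewrite /swap_seq (negPf (nt _ xt)) xt; apply: set_nth_default.
  by rewrite sz index_mem.
have fst x : x \in s -> swap_seq s t x \in t.
  by move=> xs; rewrite fs // mem_nth // -sz index_mem.
have fts x : x \in t -> swap_seq s t x \in s.
  by move=> xs; rewrite ft // mem_nth // sz index_mem.
have fn x : x \notin s -> x \notin t -> swap_seq s t x = x.
  by move=> xs xt; rewrite /swap_seq (negPf xs) (negPf xt).
(* Nine cases, as each of [x] and [y] is in [s], in [t] or in neither; when they lie in different
   places, both sides are false. *)
move=> x y; case: (boolP (x \in s)) => xs; [|case: (boolP (x \in t)) => xt];
  (case: (boolP (y \in s)) => ys; [|case: (boolP (y \in t)) => yt]).
- rewrite !fs // ht ?index_mem -?sz ?index_mem //.
  by rewrite -hs ?index_mem // !nth_index.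
- by rewrite (no _ ct _ _ (fst _ xs) (ns _ (fts _ yt))) (no _ cs).
- by rewrite (fn y) // (no _ ct _ _ (fst _ xs)) // (no _ cs).
- by rewrite (no _ cs _ _ (fts _ xt) (nt _ (fst _ ys))) (no _ ct) ?ns.
- rewrite !ft // hs ?sz ?index_mem //.
  by rewrite -ht ?index_mem // !nth_index.
- by rewrite (fn y) // (no _ cs _ _ (fts _ xt)) // (no _ ct).
- by rewrite (fn x) // adj_sym (no _ ct _ _ (fst _ ys)) // adj_sym (no _ cs).
- by rewrite (fn x) // adj_sym (no _ cs _ _ (fts _ yt)) // adj_sym (no _ ct).
- by rewrite !fn.
Qed.

(** * Da-edecks *)

Lemma eqv_refl (c : da_ecard) : da_ecard_eqv c c.
Proof. by rewrite /da_ecard_eqv giso_refl eqxx. Qed.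

Lemma eqv_sym (c d : da_ecard) : da_ecard_eqv c d = da_ecard_eqv d c.
Proof. by rewrite /da_ecard_eqv giso_sym eq_sym. Qed.

Lemma eqv_trans (d c e : da_ecard) :
  da_ecard_eqv c d -> da_ecard_eqv d e -> da_ecard_eqv c e.
Proof.
move=> /andP[h1 /eqP h2] /andP[h3 /eqP h4].
by rewrite /da_ecard_eqv (giso_trans h1 h3) h2 h4 eqxx.
Qed.

Lemma eqv_eql (c d : da_ecard) : da_ecard_eqv c d -> da_ecard_eqv c =1 da_ecard_eqv d.
Proof.
move=> h e; apply/idP/idP; last exact: eqv_trans.
by apply: eqv_trans; rewrite eqv_sym.
Qed.

Definition card_of (G : sgraph) (e : {set G}) : da_ecard := (del_edge e, edge_deg e).

(** Its cardinal is the multiplicity of [c] in the da-edeck of [H]; working with edges of [H] allows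
    automorphisms to act. *)
Definition matching_edges (c : da_ecard) (H : sgraph) : {set {set H}} :=
  [set e in edges H | da_ecard_eqv c (card_of e)].

Lemma count_edeck (c : da_ecard) (H : sgraph) :
  count (da_ecard_eqv c) (da_edeck H) = #|matching_edges c H|.
Proof.
rewrite count_map /matching_edges cardE -size_filter; apply: perm_size.
apply: uniq_perm; [by rewrite filter_uniq ?enum_uniq | exact: enum_uniq | move=> e].
by rewrite mem_filter !mem_enum [RHS]inE andbC.
Qed.

(** The multiset consists of [k] copies of [c], so containment in a da-edeck is a single inequality
    on multiplicities. *)
Lemma determined_by_nseq (G : sgraph) (c : da_ecard) (k : nat) :
    k <= #|matching_edges c G| ->
    (forall H : sgraph, k <= #|matching_edges c H| -> giso G H) ->
  determined_by G k.
Proof.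
move=> hG hH; exists (nseq k c); split; first exact: size_nseq.
  move=> d; rewrite count_nseq; case: (boolP (da_ecard_eqv d c)) => // h.
  by rewrite mul1n (eq_count (eqv_eql h)) count_edeck.
move=> H /negP nGH sub; apply/nGH/hH; rewrite -count_edeck.
by apply: leq_trans (sub c); rewrite count_nseq eqv_refl mul1n.
Qed.

Lemma sub_edeck_eqv (G : sgraph) (s : seq da_ecard) (c : da_ecard) :
    sub_multiset s (da_edeck G) -> has (da_ecard_eqv c) s ->
  exists2 e : {set G}, e \in edges G & da_ecard_eqv c (card_of e).
Proof.
move=> sub; rewrite has_count => /leq_trans/(_ (sub c)); rewrite count_edeck.
by case/card_gt0P=> e; rewrite inE => /andP[]; exists e.
Qed.

(** When all cards of [G] are equivalent, a multiset of at most [k] of them is just copies of [c],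
    and the da-edeck of [H] contains it too. *)
Lemma determined_by_gt (G H : sgraph) (c : da_ecard) (j k : nat) :
    {in edges G, forall e, da_ecard_eqv c (card_of e)} ->
    ~~ giso G H -> k <= #|matching_edges c H| ->
  determined_by G j -> k < j.
Proof.
move=> hc nGH hk [s [sz sub /(_ H nGH) det]]; rewrite ltnNge; apply/negP=> jk.
apply: det => d; case: (boolP (has (da_ecard_eqv d) s)) => [hs|]; last first.
  by rewrite has_count -leqNgt leqn0 => /eqP->.
have [e /hc ce de] := sub_edeck_eqv sub hs.
have dc : da_ecard_eqv d c by apply: eqv_trans de _; rewrite eqv_sym.
rewrite (eq_count (eqv_eql dc) (da_edeck H)) count_edeck.
by apply: leq_trans hk; apply: leq_trans jk; rewrite -sz count_size.
Qed.

(** The empty multiset lies in every da-edeck, in particular in that of the graph without vertices,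
    from which [G] differs by having the vertex [x]. *)
Lemma determined_by_gt0 (G : sgraph) (x : G) (j : nat) : determined_by G j -> 0 < j.
Proof.
case=> s [sz _ /(_ (complete 0)) det]; rewrite lt0n; apply/eqP=> j0.
move: sz; rewrite j0 => /size0nil s0; apply: det; last by rewrite s0 => c.
by apply/negP=> /giso_iso_fun[f _]; case: (f x).
Qed.

(** Here the cards of [G] may differ, so every edge needs its own graph [H] sharing that one
    card. *)
Lemma determined_by_gt1 (G : sgraph) (x : G) (j : nat) :
    {in edges G, forall e, exists2 H : sgraph,
       ~~ giso G H & 0 < #|matching_edges (card_of e) H|} ->
  determined_by G j -> 1 < j.
Proof.
move=> hH det; have := determined_by_gt0 x det; case: j det => [|[|]] // det _.
case: det => s [sz sub det]; case: s sz sub det => [|c []] // _ sub det.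
have [|e eG ce] := sub_edeck_eqv sub (c := c); first by rewrite /= eqv_refl.
have [H nGH hm] := hH e eG; case: (det H nGH) => d /=; rewrite addn0.
case: (boolP (da_ecard_eqv d c)) => // dc.
by rewrite (eq_count (eqv_eql (eqv_trans dc ce))) count_edeck.
Qed.

(** The map goes from [H] to [G], so that the degree condition on the ends of [e] is read in the
    card of [G], where the degrees are known. *)
Lemma matching_edgeP (G H : sgraph) (d : {set G}) (e : {set H}) :
    e \in matching_edges (card_of d) H ->
  e \in edges H /\ exists f : H -> G,
    @iso_fun (del_edge e) (del_edge d) f /\ exists x y,
    [/\ adj x y, e = [set x; y] &
        @deg (del_edge d) (f x) + @deg (del_edge d) (f y) = edge_deg d].
Proof.
rewrite inE => /andP[he /andP[/=]]; rewrite giso_sym => /giso_iso_fun[f hf] /eqP ->.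
split=> //; exists f; split=> //; case/edgesP: he => x [y [h E]].
exists x, y; split=> //; rewrite E edge_deg_del_edge // -E.
by congr (_ + _); apply: (deg_iso_fun _ hf).
Qed.

Lemma card_of_eqv (G H : sgraph) (f : G -> H) (e : {set G}) :
  e \in edges G -> iso_fun f -> da_ecard_eqv (card_of e) (card_of (f @: e)).
Proof.
move=> /edgesP[x [y [h E]]] hf.
rewrite /da_ecard_eqv (gisoI (iso_fun_del_edge e hf)) /= E imsetU1 imset_set1.
by rewrite !edge_deg_set2 // ?(deg_iso_fun _ hf) //; case: hf => _ ->.
Qed.

(** * Adding an edge to a card *)

Section AddEdge.
Variables (G : sgraph) (x y : G).

(** The guard [u != v] keeps the relation irreflexive even when [x = y]. *)
Definition add_edge_rel : rel G :=
  fun u v => adj u v || (u != v) && ([set u; v] == [set x; y]).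

Lemma add_edge_sym : symmetric add_edge_rel.
Proof. by move=> u v; rewrite /add_edge_rel adj_sym eq_sym setUC. Qed.

Lemma add_edge_irr : irreflexive add_edge_rel.
Proof. by move=> u; rewrite /add_edge_rel adj_irr eqxx. Qed.

Definition add_edge : sgraph := SGraph add_edge_sym add_edge_irr.

Hypotheses (nxy : x != y) (naxy : ~~ adj x y).

Lemma adj_add_edge : @adj add_edge x y.
Proof. by rewrite /= /add_edge_rel nxy eqxx orbT. Qed.

Lemma iso_fun_del_add_edge :
  @iso_fun (@del_edge add_edge [set x; y]) G id.
Proof.
split=> [|u v]; first by exists id.
rewrite /= /del_edge_rel /= /add_edge_rel.
case: (@eqP _ [set u; v]) => [/eqP|]; rewrite /= ?andbF ?orbF ?andbT //.
rewrite (@edge_eqE add_edge _ _ _ _ adj_add_edge).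
by case/orP=> /andP[/eqP-> /eqP->]; rewrite 1?[adj y x]adj_sym (negPf naxy).
Qed.

Lemma deg_add_edge (u : G) : @deg add_edge u = @deg G u + (u \in [set x; y]).
Proof.
rewrite (@deg_del_edge add_edge _ u (mem_edges adj_add_edge)).
by congr (_ + _); rewrite -(deg_iso_fun _ iso_fun_del_add_edge).
Qed.

End AddEdge.

(** A converse to [matching_edgeP], used to build the graphs that share cards with [G]. *)
Lemma add_edge_matching (G : sgraph) (d : {set G}) (x y : G) :
    x != y -> ~~ @adj (del_edge d) x y ->
    @deg (del_edge d) x + @deg (del_edge d) y = edge_deg d ->
  [set x; y] \in matching_edges (card_of d) (@add_edge (del_edge d) x y).
Proof.
move=> nxy na hd; have ha := adj_add_edge (G := del_edge d) nxy.
rewrite inE (mem_edges ha) /da_ecard_eqv /= giso_sym.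
rewrite (gisoI (iso_fun_del_add_edge (G := del_edge d) nxy na)) edge_deg_set2 //.
rewrite !deg_add_edge // !inE !eqxx orbT -hd /=; lia.
Qed.

(** * Triangles and stars as components *)

(** Replaces the subtype of a component by a map from the model graph [K]. Its image is closed under
    adjacency, so degrees in [G] can be computed in [K]. *)
Lemma component_embedding (G K : sgraph) (x : G) :
    giso (induced [set y | connect (@adj G) x y]) K ->
  exists h : K -> G, [/\ injective h,
    forall a b, adj (h a) (h b) = adj a b,
    forall a z, adj (h a) z -> exists b, z = h b &
    exists a, x = h a].
Proof.
set C := [set y | _] => /giso_iso_fun[f [[g fK gK] hf]].
exists (fun a => val (g a)); split.
- by move=> a b /val_inj/(can_inj gK).
- by move=> a b; rewrite -[in RHS](gK a) -[in RHS](gK b) hf.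
- move=> a z h; have zC : z \in C.
    move: (valP (g a)); rewrite !inE => /connect_trans; apply; exact: connect1.
  by exists (f (Sub z zC)); rewrite fK SubK.
have xC : x \in C by rewrite inE connect0.
by exists (f (Sub x xC)); rewrite fK SubK.
Qed.

Lemma deg_embedding (G K : sgraph) (h : K -> G) (a : K) :
    injective h -> (forall a b, adj (h a) (h b) = adj a b) ->
    (forall a z, adj (h a) z -> exists b, z = h b) ->
  deg (h a) = deg a.
Proof.
move=> hi hm hc; rewrite /deg -(card_imset _ hi); apply: eq_card => y.
rewrite !inE; apply/idP/imsetP=> [ay|[b]]; last by rewrite inE -hm => ? ->.
by have [b E] := hc _ _ ay; exists b => //; rewrite inE -hm -E.
Qed.

(** A local trace of lying in a triangle component. Alone it does not bound the degrees of the
    neighbours; [tri_vertex_nbr] does so once every vertex of the graph is of a known kind. *)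
Definition tri_vertex (G : sgraph) (x : G) : Prop :=
  deg x = 2 /\ forall y z, adj x y -> adj x z -> y != z -> adj y z.

Definition star_center (t : nat) (G : sgraph) (c : G) : Prop :=
  deg c = t /\ forall q, adj c q -> deg q = 1.

Definition star_vertex (t : nat) (G : sgraph) (x : G) : Prop :=
  star_center t x \/ exists2 c, star_center t c & adj c x.

Lemma component_tri_vertex (G : sgraph) (x : G) :
    giso (induced [set y | connect (@adj G) x y]) (complete 3) ->
  tri_vertex x.
Proof.
case/component_embedding=> h [hi hm hc [a ->]]; split.
  rewrite (deg_embedding _ hi hm hc) /deg.
  rewrite (_ : [set y | _] = [set~ a]) ?cardsC1 ?card_ord //.
  by apply/setP=> b; rewrite !inE /= /complete_rel eq_sym.
move=> y z hy hz; have [b Eb] := hc _ _ hy; have [c Ec] := hc _ _ hz; subst y z.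
by rewrite hm /= /complete_rel (inj_eq hi).
Qed.

Lemma component_star_vertex (t : nat) (G : sgraph) (x : G) :
    giso (induced [set y | connect (@adj G) x y]) (star t) ->
  star_vertex t x.
Proof.
case/component_embedding=> h [hi hm hc [a ->]].
have dr b : deg (h (inr b)) = 1.
  rewrite (deg_embedding _ hi hm hc) /deg.
  rewrite (_ : [set y | _] = [set inl ord0]) ?cards1 //.
  by apply/setP=> -[i|i]; rewrite !inE //= ord1 eqxx.
have sc : star_center t (h (inl ord0)).
  split=> [|q hq]; last first.
    have [b E] := hc _ _ hq; move: hq; rewrite E hm.
    by case: b {E} => // b _; apply: dr.
  rewrite (deg_embedding _ hi hm hc) /deg.
  rewrite (_ : [set y | _] = inr @: [set: 'I_t]).
    by rewrite card_imset ?cardsT ?card_ord // => ? ? [].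
  apply/setP=> -[i|i]; rewrite !inE; first by apply/esym/negP=> /imsetP[].
  by rewrite mem_imset ?inE // => ? ? [].
case: a => [i|i]; first by left; rewrite ord1.
by right; exists (h (inl ord0)); rewrite // hm.
Qed.

Lemma component_isolated (G : sgraph) (x : G) :
  ~~ nontrivial [set y | connect (@adj G) x y] -> deg x = 0.
Proof.
rewrite /nontrivial -leqNgt => /card_le1_eqP h; apply/eqP.
rewrite cards_eq0; apply/eqP/setP=> y; rewrite !inE; apply/negP=> xy.
have := h x y; rewrite !inE connect0 connect1 // => /(_ isT isT) E.
by move: (adj_neq xy); rewrite E eqxx.
Qed.

Lemma two_nontrivial_components (G : sgraph) :
    1 < #|[set C in components G | nontrivial C]| ->
  exists x y : G, [/\ nontrivial [set z | connect (@adj G) x z], deg y != 0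
                   & ~~ connect (@adj G) x y].
Proof.
have nz (x : G) : nontrivial [set y | connect (@adj G) x y] -> deg x != 0.
  move=> /card_gt1P[a [b [+ + nab]]]; rewrite !inE => ca cb.
  have [z cz nz] : exists2 z, connect (@adj G) x z & x != z.
    have [E|] := eqVneq x a; last by exists a.
    by exists b => //; rewrite E.
  case/connectP: cz => -[|w p] /=; first by move=> _ E; rewrite E eqxx in nz.
  case/andP=> xw _ _; rewrite -lt0n; apply/card_gt0P; exists w; by rewrite inE.
case/card_gt1P=> C1 [C2 [+ + nC]]; rewrite !inE => /andP[/imsetP[x _ E1] n1].
case/andP=> /imsetP[y _ E2] n2; subst C1 C2; exists x, y; split; rewrite ?nz //.
apply: contra nC => cxy; apply/eqP/setP=> z; rewrite !inE.
exact: (same_connect (sym_connect_sym (@adj_sym G)) cxy).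
Qed.

(** * Neighbourhoods as lists *)

Lemma nbhd_seq (G : sgraph) (x : G) (s : seq G) :
  uniq s -> all (adj x) s -> size s = deg x -> forall z, adj x z = (z \in s).
Proof.
move=> us /allP hs sz z.
suff /setP/(_ z) : [set y in s] = [set y | adj x y] by rewrite !inE.
apply/eqP; rewrite eqEcard; apply/andP; split.
  by apply/subsetP=> y; rewrite !inE => /hs.
by rewrite [leqRHS]cardsE (card_uniqP us) sz.
Qed.

Lemma nbhd_cons (G : sgraph) (x q : G) : adj x q ->
  exists s, [/\ uniq (q :: s), (size s).+1 = deg x & forall z, adj x z = (z \in q :: s)].
Proof.
move=> xq; exists (enum ([set y | adj x y] :\ q)); split.
- by rewrite /= enum_uniq andbT mem_enum !inE eqxx.
- by rewrite -cardE /deg [RHS](cardsD1 q) inE xq.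
by move=> z; rewrite inE mem_enum !inE; case: eqVneq => [->|].
Qed.

Lemma deg1_nbhd (G : sgraph) (x y : G) :
  deg x = 1 -> adj x y -> forall z, adj x z = (z == y).
Proof.
by move=> d h z; rewrite (@nbhd_seq _ x [:: y]) ?inE //= h.
Qed.

Lemma adj_deg_gt0 (G : sgraph) (x y : G) (n : nat) : adj x y -> deg x = n -> 0 < n.
Proof. by move=> h <-; apply/card_gt0P; exists y; rewrite inE. Qed.

Lemma deg_del_edgeB (G : sgraph) (e : {set G}) (x : G) :
  e \in edges G -> @deg (del_edge e) x = deg x - (x \in e).
Proof. by move=> he; rewrite (deg_del_edge x he) addnK. Qed.

Lemma set2_edge (G : sgraph) (e : {set G}) (x y : G) :
  e \in edges G -> x \in e -> y \in e -> x != y -> [set x; y] = e.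
Proof.
move=> he xe ye nxy; have [z hz E] := edge_at he xe.
by move: ye; rewrite E !inE eq_sym (negPf nxy) => /eqP->.
Qed.

(** The isomorphism of cards sends the deleted edge to the deleted edge, so it survives putting both
    back. Contrapositively, if [H] is not isomorphic to [G], some end of the added edge falls
    outside [d]. *)
Lemma matching_edge_giso (G H : sgraph) (d : {set G}) (f : H -> G) (x y : H) :
    d \in edges G -> adj x y ->
    @iso_fun (del_edge [set x; y]) (del_edge d) f ->
    f x \in d -> f y \in d -> giso G H.
Proof.
move=> dG xy hf xd yd; rewrite giso_sym.
apply: (giso_of_del_edge (mem_edges xy) dG hf).
rewrite imsetU1 imset_set1; apply: (set2_edge dG xd yd).
by rewrite (inj_eq (bij_inj hf.1)); exact: adj_neq xy.
Qed.

Lemma giso_deg (G H : sgraph) (y : H) : giso G H -> exists x : G, deg x = deg y.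
Proof.
rewrite giso_sym => /giso_iso_fun[f hf]; exists (f y); exact: deg_iso_fun hf.
Qed.

Lemma iso_fun_nbhd (G H : sgraph) (f : G -> H) (x : G) :
  iso_fun f -> f @: [set z | adj x z] = [set z | adj (f x) z].
Proof.
case=> -[g fK gK] hf; apply/setP=> z; rewrite inE; apply/imsetP/idP=> [[y]|h].
  by rewrite inE -hf => ? ->.
by exists (g z); rewrite ?inE ?gK // -hf gK.
Qed.

(** * Triangle and claw components, and automorphisms moving their edges *)

Definition triangle (G : sgraph) (r p q : G) : Prop :=
  [/\ uniq [:: r; p; q], forall z, adj r z = (z \in [:: p; q]),
      forall z, adj p z = (z \in [:: r; q])
    & forall z, adj q z = (z \in [:: r; p])].

(** The centre is [p]. Neighbourhoods are listed in full, so the four vertices form a whole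
    component. *)
Definition claw (G : sgraph) (p q l m : G) : Prop :=
  [/\ uniq [:: p; q; l; m], forall z, adj p z = (z \in [:: q; l; m])
    & {in [:: q; l; m], forall x z, adj x z = (z == p)}].

Lemma tri_vertex_triangle (G : sgraph) (p q : G) :
    tri_vertex p -> deg q = 2 -> adj p q ->
    (forall z, adj p z -> deg z = 2) -> exists r, triangle r p q.
Proof.
move=> [dp hp] dq pq d2; have [s [us sz hs]] := nbhd_cons pq.
case: s us sz hs => [|r [|? ?]] us sz hs; rewrite dp // in sz.
have pr : adj p r by rewrite hs !inE eqxx orbT.
have nqr : q != r by move: us; rewrite /= inE andbT.
have qr := hp _ _ pq pr nqr.
have [npq npr] := (adj_neq pq, adj_neq pr).
have [qp rp rq] : [/\ adj q p, adj r p & adj r q] by split; rewrite adj_sym.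
exists r; split.
- by rewrite /= !inE !negb_or npq andbT [r == p]eq_sym npr [r == q]eq_sym nqr.
- by apply: nbhd_seq; rewrite /= ?inE ?npq ?rp ?rq // d2.
- by apply: nbhd_seq; rewrite /= ?inE ?pr ?pq ?dp // 1?eq_sym ?nqr.
- by apply: nbhd_seq; rewrite /= ?inE ?qr ?qp ?dq // 1?eq_sym ?npr.
Qed.

Lemma triangle_automorphism (G : sgraph) (r p q r' p' q' : G) :
    triangle r p q -> triangle r' p' q' ->
  exists2 f : G -> G, iso_fun f & f @: [set p; q] = [set p'; q'].
Proof.
move=> [us hr hp hq] [us' hr' hp' hq'].
(* Each edge is the neighbourhood of the opposite vertex, so an automorphism sending [r] to [r'] is
   enough: a transposition within one triangle, an exchange of the two triangles otherwise. *)
have -> : [set p; q] = [set z | adj r z] by apply/setP=> z; rewrite !inE hr !inE.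
have -> : [set p'; q'] = [set z | adj r' z] by apply/setP=> z; rewrite !inE hr' !inE.
case: (boolP (r' \in [:: r; p; q])) => [hin|nin].
  suff tp : iso_fun (tperm r r' : G -> G).
    by exists (tperm r r'); rewrite // iso_fun_nbhd // tpermL.
  apply: iso_fun_tperm => z nr nr'.
  move: hin nr'; rewrite !inE => /or3P[]/eqP->// nr';
    by rewrite hr ?hp ?hq !inE (negPf nr) (negPf nr') ?orbF.
have cl : {in [:: r; p; q], forall x y, adj x y -> y \in [:: r; p; q]}.
  move=> x; rewrite !inE => /or3P[]/eqP-> y; rewrite ?hr ?hp ?hq !inE;
    by case/orP=> ->; rewrite ?orbT.
have cl' : {in [:: r'; p'; q'], forall x y, adj x y -> y \in [:: r'; p'; q']}.
  move=> x; rewrite !inE => /or3P[]/eqP-> y; rewrite ?hr' ?hp' ?hq' !inE;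
    by case/orP=> ->; rewrite ?orbT.
have ucat : uniq ([:: r; p; q] ++ [:: r'; p'; q']).
  rewrite cat_uniq us us' andbT; apply/hasPn=> x xt; apply: contra nin => xs.
  move: xt xs; rewrite inE => /predU1P[->//|xt] xs; apply: cl xs _ _.
  by move: xt; rewrite !inE => /orP[]/eqP->; rewrite ?hp' ?hq' !inE eqxx.
have tab s0 s1 s2 : triangle s0 s1 s2 -> forall i j, i < 3 -> j < 3 ->
    adj (nth r [:: s0; s1; s2] i) (nth r [:: s0; s1; s2] j) = (i != j).
  case=> /and3P[]; rewrite !inE negb_or => /andP[/negPf n1 /negPf n2] /negPf n3 _ h0 h1 h2.
  have [m1 m2 m3] : [/\ (s1 == s0) = false, (s2 == s0) = false & (s2 == s1) = false].
    by split; rewrite eq_sym.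
  by move=> [|[|[|]]] // [|[|[|]]] // _ _;
     rewrite /= ?h0 ?h1 ?h2 !inE ?eqxx ?n1 ?n2 ?n3 ?m1 ?m2 ?m3.
have sw : iso_fun (swap_seq [:: r; p; q] [:: r'; p'; q']).
  by apply: (iso_fun_swap_seq (R := fun i j => i != j) (x0 := r) ucat) => //; apply: tab.
exists (swap_seq [:: r; p; q] [:: r'; p'; q']) => //; rewrite iso_fun_nbhd //.
by rewrite /swap_seq inE eqxx /= eqxx.
Qed.

Lemma star_center_claw (G : sgraph) (p q : G) :
  star_center 3 p -> adj p q -> exists l m, claw p q l m.
Proof.
move=> [dp hp] pq; have [s [us sz hs]] := nbhd_cons pq.
case: s us sz hs => [|l [|m [|? ?]]] us sz hs; rewrite dp // in sz.
exists l, m; split=> //.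
  rewrite cons_uniq us andbT; apply/negP=> /=.
  by rewrite -hs adj_irr.
move=> x; rewrite -hs => px; apply: deg1_nbhd; first exact: hp.
by rewrite adj_sym.
Qed.

Lemma claw_automorphism (G : sgraph) (p q l m p' q' l' m' : G) :
    claw p q l m -> claw p' q' l' m' ->
  exists2 f : G -> G, iso_fun f & f @: [set p; q] = [set p'; q'].
Proof.
move=> [us hp hl] [us' hp' hl'].
have pq : adj p q by rewrite hp inE eqxx.
have pq' : adj p' q' by rewrite hp' inE eqxx.
(* With a common centre it suffices to transpose two leaves; otherwise the two claws are disjoint
   and are exchanged as wholes. *)
have [E|np] := eqVneq p p'.
  subst p'; exists (tperm q q').
    by apply: iso_fun_tperm => z _ _; rewrite hl ?hl' ?inE ?eqxx.
  by rewrite imsetU1 imset_set1 tpermL tpermD // eq_sym adj_neq.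
have nl u : u \in [:: q; l; m] -> u \in [:: q'; l'; m'] -> False.
  move=> uq uq'; have : adj u p by rewrite hl.
  by rewrite hl' // (negPf np).
(* A centre has two distinct neighbours, so it is not a leaf of the other claw. *)
have deg3 (a b c d x : G) : claw a b c d -> ~ forall z, adj a z = (z == x).
  case=> /and3P[_ + _] ha _ h; rewrite !inE negb_or => /andP[+ _].
  have /eqP-> : b == x by rewrite -h ha !inE eqxx.
  have /eqP-> : c == x by rewrite -h ha !inE eqxx orbT.
  by rewrite eqxx.
have c1 : claw p q l m by [].
have c2 : claw p' q' l' m' by [].
have ucat : uniq ([:: p; q; l; m] ++ [:: p'; q'; l'; m']).
  rewrite cat_uniq us us' andbT; apply/hasPn=> x xt; apply/negP=> xs.
  move: xt xs; rewrite [x \in p' :: _]inE [x \in p :: _]inE.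
  move=> /predU1P[->|xt] /predU1P[E|xs].
  - by rewrite E eqxx in np.
  - by apply: (deg3 _ _ _ _ p c2); apply: hl.
  - by rewrite E in xt; apply: (deg3 _ _ _ _ p' c1); apply: hl'.
  - exact: nl xs xt.
have cl a b c d : claw a b c d ->
    {in [:: a; b; c; d], forall x y, adj x y -> y \in [:: a; b; c; d]}.
  case=> _ ha hb x; rewrite inE => /predU1P[->|xb] y.
    by rewrite ha => yb; rewrite inE yb orbT.
  by rewrite hb // => /eqP->; rewrite inE eqxx.
have tab a b c d : claw a b c d -> forall i j, i < 4 -> j < 4 ->
    adj (nth p [:: a; b; c; d] i) (nth p [:: a; b; c; d] j) = (i == 0) (+) (j == 0).
  case=> /and4P[+ _ _ _]; rewrite !inE !negb_or => /and3P[/negPf n1 /negPf n2 /negPf n3] h0 h1.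
  have [m1 m2 m3] : [/\ (b == a) = false, (c == a) = false & (d == a) = false].
    by split; rewrite eq_sym.
  by move=> [|[|[|[|]]]] // [|[|[|[|]]]] // _ _;
     rewrite /= ?h0 ?h1 ?inE ?eqxx ?n1 ?n2 ?n3 ?m1 ?m2 ?m3 ?orbT.
exists (swap_seq [:: p; q; l; m] [:: p'; q'; l'; m']).
  apply: (iso_fun_swap_seq (R := fun i j => (i == 0) (+) (j == 0)) (x0 := p) ucat) => //;
    by [exact: cl | exact: tab].
rewrite imsetU1 imset_set1 /swap_seq !inE !eqxx orbT /= eqxx.
by rewrite (negPf (adj_neq pq)) eqxx.
Qed.

Lemma self_matching (G : sgraph) (e : {set G}) :
  e \in edges G -> e \in matching_edges (card_of e) G.
Proof. by move=> he; rewrite inE he eqv_refl. Qed.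

Lemma iso_fun_edges (G H : sgraph) (f : G -> H) (e : {set G}) :
  iso_fun f -> e \in edges G -> f @: e \in edges H.
Proof.
move=> [_ hf] /edgesP[x [y [h ->]]]; rewrite imsetU1 imset_set1.
by apply: mem_edges; rewrite hf.
Qed.

Lemma iso_fun_matching (G : sgraph) (c : da_ecard) (f : G -> G) (e : {set G}) :
  iso_fun f -> e \in matching_edges c G -> f @: e \in matching_edges c G.
Proof.
move=> hf; rewrite [e \in matching_edges _ _]inE [_ @: _ \in matching_edges _ _]inE.
case/andP=> he ce.
by rewrite iso_fun_edges //=; apply: eqv_trans ce (card_of_eqv he hf).
Qed.

Lemma deg0_adj (G : sgraph) (x : G) : deg x = 0 -> forall z, adj x z = false.
Proof.
by move/eqP; rewrite cards_eq0 => /eqP/setP h z; have := h z; rewrite !inE.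
Qed.

Lemma deg_neq0 (G : sgraph) (x : G) : deg x != 0 -> exists y, adj x y.
Proof. by rewrite -lt0n => /card_gt0P[y]; rewrite inE; exists y. Qed.

Lemma star_vertex_deg (t : nat) (G : sgraph) (x : G) :
  star_vertex t x -> deg x = t \/ deg x = 1.
Proof. by case=> [[]|[c [_ h] /h]]; auto. Qed.

Lemma star_vertex_center (t : nat) (G : sgraph) (x : G) :
  star_vertex t x -> deg x = t -> t != 1 -> star_center t x.
Proof. by move=> [//|[c [_ h] /h ->]] <-. Qed.

Lemma star_vertex_edge (t : nat) (G : sgraph) (x y : G) :
    star_vertex t x -> adj x y ->
  exists p q, [/\ star_center t p, adj p q & [set x; y] = [set p; q]].
Proof.
move=> [cx|[c hc cx]] xy; first by exists x, y.
move: xy; rewrite (deg1_nbhd (y := c)) ?hc.2 // 1?adj_sym // => /eqP->.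
by exists c, x; rewrite setUC.
Qed.

(** If [q] were the centre of a claw, [p] would have degree 1; if [q] were a leaf, [p] would be its
    centre and have degree 3. *)
Lemma tri_vertex_nbr (G : sgraph) (p q : G) :
    (forall x : G, [\/ deg x = 0, tri_vertex x | star_vertex 3 x]) ->
  tri_vertex p -> adj p q -> deg q = 2.
Proof.
move=> hG [dp _] pq; have qp : adj q p by rewrite adj_sym.
case: (hG q) => [q0|[]//|[[_ /(_ p qp)]|[c [dc hc] cq]]].
- by have := adj_deg_gt0 qp q0.
- by rewrite dp.
- move: qp; rewrite (deg1_nbhd (y := c)) ?hc // 1?adj_sym // => /eqP pc.
  by move: dp; rewrite pc dc.
Qed.

Lemma tri_vertex_edge (G : sgraph) (p q : G) :
    (forall x : G, [\/ deg x = 0, tri_vertex x | star_vertex 3 x]) ->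
  tri_vertex p -> adj p q -> exists r, triangle r p q.
Proof.
move=> hG hp pq; apply: tri_vertex_triangle => //; first exact: tri_vertex_nbr pq.
by move=> z; apply: tri_vertex_nbr.
Qed.

(** * Values of dern *)

(** If only the ends of [e] have the prescribed degree sum in the card, the edge can be put back in
    one way only. *)
Lemma is_dern1 (G : sgraph) (e : {set G}) : e \in edges G ->
    (forall (H : sgraph) (f : H -> G) (x y : H),
       adj x y -> f x != f y ->
       @deg (del_edge e) (f x) + @deg (del_edge e) (f y) = edge_deg e ->
       f x \in e /\ f y \in e) ->
  is_dern G 1.
Proof.
move=> he hH; split=> [|j]; last first.
  by case/edgesP: he => x _; apply: (determined_by_gt0 x).
apply: (@determined_by_nseq _ (card_of e)).
  by apply/card_gt0P; exists e; apply: self_matching.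
move=> H /card_gt0P[d /matching_edgeP[dH [f [hf [x [y [xy E hd]]]]]]].
have nf : f x != f y by rewrite (inj_eq (bij_inj hf.1)); apply: adj_neq xy.
have [xe ye] := hH _ _ _ _ xy nf hd.
by rewrite E in hf; apply: (matching_edge_giso he xy hf).
Qed.

(** In the card the ends of the deleted edge have degree 1 and all other vertices degree 2, so the
    sum 2 is reached by those ends alone. *)
Lemma dern_triangles (G : sgraph) (x0 : G) :
  (forall x : G, tri_vertex x) -> is_dern G 1.
Proof.
move=> hG; have [p pq] : exists y, adj x0 y by apply: deg_neq0; rewrite (proj1 (hG x0)).
have he := mem_edges pq; apply: (is_dern1 he) => H f x y _ _.
rewrite edge_deg_set2 // !(deg_del_edgeB _ he).
rewrite !(proj1 (hG _)); case: (f x \in _); case: (f y \in _) => //=; lia.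
Qed.

(** The required sum is [t - 1]. In the card the ends of the deleted edge have degrees [t - 1] and
    0, the other vertices [t] or 1; the competing sum 1 + 1 would need [t = 3]. *)
Lemma dern_stars (t : nat) (G : sgraph) (x0 : G) : 3 < t ->
  (forall x : G, star_vertex t x) -> is_dern G 1.
Proof.
move=> t3 hG; have [y0 xy0] : exists y, adj x0 y.
  by apply: deg_neq0; case: (star_vertex_deg (hG x0)) => ->; lia.
have [p [q [hp pq _]]] := star_vertex_edge (hG x0) xy0.
have he := mem_edges pq; apply: (is_dern1 he) => H f x y _ nf.
rewrite edge_deg_set2 // !(deg_del_edgeB _ he) !inE.
have [dp dq] : deg p = t /\ deg q = 1 by split; [apply: hp.1 | apply: hp.2].
have := star_vertex_deg (hG (f x)); have := star_vertex_deg (hG (f y)).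
case: (eqVneq (f x) p) => [Ex|nxp]; case: (eqVneq (f x) q) => [Ex'|nxq];
  case: (eqVneq (f y) p) => [Ey|nyp]; case: (eqVneq (f y) q) => [Ey'|nyq] //=;
  rewrite ?Ex ?Ex' ?Ey ?Ey' ?dp ?dq; try lia.
all: move: nf; rewrite ?Ex ?Ex' ?Ey ?Ey' ?eqxx //.
Qed.

Lemma adj_add_edgeW (G : sgraph) (x y u v : G) : adj u v -> @adj (add_edge x y) u v.
Proof. by move=> h; rewrite /= /add_edge_rel h. Qed.

Lemma adj_del_edgeI (G : sgraph) (e : {set G}) (u v z : G) :
  adj u v -> z \in [set u; v] -> z \notin e -> @adj (del_edge e) u v.
Proof.
move=> h zuv ze; rewrite /= /del_edge_rel h; apply/eqP=> E.
by rewrite -E zuv in ze.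
Qed.

Lemma matching_edges_all (G : sgraph) (c : da_ecard) :
    {in edges G, forall e, da_ecard_eqv c (card_of e)} ->
  matching_edges c G = edges G.
Proof.
move=> hc; apply/setP=> e; rewrite [LHS]inE; case: (boolP (e \in edges G)) => //=.
exact: hc.
Qed.

(** All cards of [G] being equivalent, the value is one more than the largest multiplicity of that
    card among graphs not isomorphic to [G]; [H] attains it. *)
Lemma is_dern_succ (G H : sgraph) (c : da_ecard) (k : nat) :
    {in edges G, forall e, da_ecard_eqv c (card_of e)} ->
    k < #|edges G| ->
    ~~ giso G H -> k <= #|matching_edges c H| ->
    (forall K : sgraph, ~~ giso G K -> #|matching_edges c K| <= k) ->
  is_dern G k.+1.
Proof.
move=> hc hk nGH hH hK; split=> [|j].
  apply: (@determined_by_nseq _ c); first by rewrite matching_edges_all.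
  by move=> K; apply: contraTT => /hK; rewrite -ltnNge.
exact: determined_by_gt hc nGH hH.
Qed.

Lemma twins_deg1 (G : sgraph) (u v r : G) :
  deg u = 1 -> deg v = 1 -> adj u r -> adj v r -> iso_fun (tperm u v : G -> G).
Proof.
move=> du dv ur vr; apply: iso_fun_tperm => z _ _.
by rewrite (deg1_nbhd du ur) (deg1_nbhd dv vr).
Qed.

Lemma twins_deg2 (G : sgraph) (u v w : G) :
    deg u = 2 -> deg v = 2 -> adj u v -> adj u w -> adj v w ->
  iso_fun (tperm u v : G -> G).
Proof.
move=> du dv uv uw vw; apply: iso_fun_tperm => z zu zv.
rewrite (@nbhd_seq _ u [:: v; w]) ?(@nbhd_seq _ v [:: u; w]) /= ?inE ?uv ?uw ?vw //.
- by rewrite (negPf zu) (negPf zv).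
- by rewrite adj_neq.
- by rewrite adj_sym uv.
- by rewrite adj_neq.
Qed.

Lemma dern_triangles_isolated (G : sgraph) (i : G) :
    (forall x : G, deg x = 0 \/ tri_vertex x) -> deg i = 0 ->
  3 < #|edges G| -> is_dern G 4.
Proof.
move=> hG di e4.
have hG3 (x : G) : [\/ deg x = 0, tri_vertex x | star_vertex 3 x].
  by case: (hG x); [constructor 1 | constructor 2].
have dG (x : G) : deg x = 0 \/ deg x = 2 by case: (hG x) => [|[]]; auto.
have triE (e : {set G}) : e \in edges G -> exists r p q, triangle r p q /\ e = [set p; q].
  case/edgesP=> p [q [pq ->]].
  case: (hG p) => [p0|hp]; first by have := adj_deg_gt0 pq p0.
  by have [r hr] := tri_vertex_edge hG3 hp pq; exists r, p, q.
have [e0 he0] : exists e, e \in edges G by apply/card_gt0P; apply: leq_trans e4.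
have [r [p [q [htri E0]]]] := triE _ he0.
have all_eqv : {in edges G, forall e, da_ecard_eqv (card_of e0) (card_of e)}.
  move=> e he; have [r' [p' [q' [htri' E']]]] := triE _ he.
  have [f hf Ef] := triangle_automorphism htri htri'.
  by have := card_of_eqv he0 hf; rewrite E0 Ef -E'.
have [us hr hp hq] := htri.
have pq : adj p q by rewrite hp !inE eqxx orbT.
have rp : adj r p by rewrite hr !inE eqxx.
have rq : adj r q by rewrite hr !inE eqxx orbT.
have d2 (x y : G) : adj x y -> deg x = 2.
  by move=> xy; case: (dG x) => // x0; have := adj_deg_gt0 xy x0.
have [dp dq dr] : [/\ deg p = 2, deg q = 2 & deg r = 2].
  by split; [apply: d2 pq | apply: (d2 q p); rewrite adj_sym | apply: d2 rp].
have ed0 : edge_deg e0 = 2 by rewrite E0 edge_deg_set2 // dp dq.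
have [nir nip niq] : [/\ i != r, i != p & i != q].
  by split; apply/eqP=> E; move: di; rewrite E ?dr ?dp ?dq.
have re0 : r \notin e0.
  by rewrite E0 !inE negb_or !adj_neq.
have ie0 : i \notin e0 by rewrite E0 !inE negb_or nip niq.
have nir' : ~~ @adj (del_edge e0) i r.
  by rewrite /= /del_edge_rel deg0_adj.
have degd := deg_del_edgeB _ he0.
(* The card contains the path with middle [r] and ends [p], [q]; the new edge makes it a claw
   centred at [r]. *)
pose H := @add_edge (del_edge e0) i r.
have degH (u : G) : @deg H u = deg u - (u \in e0) + (u \in [set i; r]).
  by rewrite (@deg_add_edge (del_edge e0)) // degd.
have [di' dp' dq' dr'] : [/\ @deg H i = 1, @deg H p = 1, @deg H q = 1 & @deg H r = 3].
  have [npr nqr] : p != r /\ q != r by rewrite ![_ == r]eq_sym !adj_neq.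
  rewrite !degH di dp dq dr (negPf re0) (negPf ie0) E0 !inE !eqxx !orbT /=.
  by rewrite ![_ == i]eq_sym (negPf nip) (negPf niq) (negPf npr) (negPf nqr).
have Hir : @adj H i r by apply: adj_add_edge.
have Hpr : @adj H p r.
  apply: adj_add_edgeW; apply: (@adj_del_edgeI _ _ _ _ r) => //; first by rewrite adj_sym.
  by rewrite !inE eqxx orbT.
have Hqr : @adj H q r.
  apply: adj_add_edgeW; apply: (@adj_del_edgeI _ _ _ _ r) => //; first by rewrite adj_sym.
  by rewrite !inE eqxx orbT.
have m0 : [set i; r] \in matching_edges (card_of e0) H.
  apply: add_edge_matching => //.
  by rewrite !degd (negPf re0) (negPf ie0) di dr ed0.
(* The leaves at [r] are twins, so all three edges of the new claw give the same card. *)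
have mv (u : H) : @deg H u = 1 -> @adj H u r -> u != r ->
    [set u; r] \in matching_edges (card_of e0) H.
  move=> du ur nur; have := iso_fun_matching (twins_deg1 di' du Hir ur) m0.
  by rewrite imsetU1 imset_set1 tpermL tpermD.
apply: (is_dern_succ all_eqv e4 (H := H)).
- apply/negP=> isoGH; have [x] := giso_deg (r : H) isoGH; rewrite dr' => dx.
  by case: (dG x); rewrite dx.
- apply/card_gt2P; exists [set i; r], [set p; r], [set q; r]; split; split=> //.
  + by apply: mv => //; apply: adj_neq Hpr.
  + by apply: mv => //; apply: adj_neq Hqr.
  + apply/eqP; rewrite ![[set _; r]]setUC => /set2_inj E.
    by rewrite E eqxx in nip.
  + apply/eqP; rewrite ![[set _; r]]setUC => /set2_inj E.
    by move: (adj_neq pq); rewrite E eqxx.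
  + apply/eqP; rewrite ![[set _; r]]setUC => /set2_inj E.
    by rewrite E eqxx in niq.
move=> K nGK.
have [->|[e1 he1]] := set_0Vmem (matching_edges (card_of e0) K); first by rewrite cards0.
(* In the card only the ends of [e0] have degree 1, and the others have 0 or 2. The sum 1 + 1 would
   give [G] back, so the added edge realises 0 + 2. *)
have bad e : e \in matching_edges (card_of e0) K -> exists x y,
    [/\ @adj K x y, e = [set x; y], deg x = 1, deg y = 3 & forall z, deg z <= 2 + (z \in e)].
  move=> /matching_edgeP[eK [f [hf [x [y [xy E hd]]]]]].
  have df z : @deg K z = @deg (del_edge e0) (f z) + (z \in e).
    by rewrite (deg_del_edge z eK) -(deg_iso_fun (z : del_edge e) hf).
  have dz z : @deg K z <= 2 + (z \in e).
    rewrite df leq_add2r degd; apply: leq_trans (leq_subr _ _) _.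
    by case: (dG (f z)) => ->.
  have := df x; have := df y; rewrite !E !inE !eqxx orbT /=.
  have : ~ (f x \in e0 /\ f y \in e0).
    case=> xe ye; case/negP: nGK; rewrite E in hf.
    exact: (matching_edge_giso he0 xy hf).
  move: hd dz; rewrite !degd ed0 E.
  case: (dG (f x)) => ->; case: (dG (f y)) => ->;
    case: (f x \in e0); case: (f y \in e0) => //= _ dz n dy dx; 
    by [case: n | exists x, y
       | exists y, x; split=> //; rewrite 1?adj_sym 1?setUC // => z; rewrite setUC].
have [x1 [y1 [xy1 E1 dx1 dy1 h1]]] := bad _ he1.
apply: (@leq_trans #|[set [set y1; z] | z in [set z | adj y1 z]]|).
  apply/subset_leq_card/subsetP=> e /bad[x [y [xy E dx dy _]]].
  (* Outside [e1] degrees are at most 2, and [x1] has degree 1, so the end of degree 3 is the same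
     for all matching edges. They are thus among the three edges at [y1]. *)
  have yy1 : y = y1.
    have := h1 y; rewrite dy E1 !inE; case: eqVneq => [Ey|_] /=.
      by move: dy; rewrite Ey dx1.
    by case: eqVneq.
  by apply/imsetP; exists x; rewrite ?inE ?E -?yy1 1?adj_sym 1?setUC.
by apply: leq_trans (leq_imset_card _ _) _; rewrite -/(deg y1) dy1.
Qed.

Lemma dern_claws (G : sgraph) :
    (forall x : G, deg x = 0 \/ star_vertex 3 x) -> 3 < #|edges G| -> is_dern G 4.
Proof.
move=> hG e4.
have dG (x : G) : [\/ deg x = 0, deg x = 1 | deg x = 3].
  by case: (hG x) => [|/star_vertex_deg[]]; [constructor 1|constructor 3|constructor 2].
have starE (e : {set G}) : e \in edges G ->
    exists p q l m, [/\ star_center 3 p, claw p q l m & e = [set p; q]].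
  case/edgesP=> x [y [xy ->]].
  case: (hG x) => [x0|hx]; first by have := adj_deg_gt0 xy x0.
  have [p [q [hp pq ->]]] := star_vertex_edge hx xy.
  by have [l [m hc]] := star_center_claw hp pq; exists p, q, l, m.
have [e0 he0] : exists e, e \in edges G by apply/card_gt0P; apply: leq_trans e4.
have [p [q [l [m [hc hcl E0]]]]] := starE _ he0.
have all_eqv : {in edges G, forall e, da_ecard_eqv (card_of e0) (card_of e)}.
  move=> e he; have [p' [q' [l' [m' [_ hcl' E']]]]] := starE _ he.
  have [f hf Ef] := claw_automorphism hcl hcl'.
  by have := card_of_eqv he0 hf; rewrite E0 Ef -E'.
have [us hp hl] := hcl.
have pq : adj p q by rewrite hp !inE eqxx.
have pl : adj p l by rewrite hp !inE eqxx orbT.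
have pm : adj p m by rewrite hp !inE eqxx !orbT.
have [dp dleaf] := hc; have [dq dl dm] := And3 (dleaf _ pq) (dleaf _ pl) (dleaf _ pm).
have ed0 : edge_deg e0 = 2 by rewrite E0 edge_deg_set2 // dp dq.
have [nql nqm nlm] : [/\ q != l, q != m & l != m].
  by move: us; rewrite /= !inE !negb_or => /and4P[_ /andP[-> ->] -> _].
have le0 : l \notin e0 by rewrite E0 !inE negb_or ![l == _]eq_sym adj_neq.
have me0 : m \notin e0 by rewrite E0 !inE negb_or ![m == _]eq_sym adj_neq.
have pe0 : p \in e0 by rewrite E0 !inE eqxx.
have nlm' : ~~ @adj (del_edge e0) l m.
  by rewrite /= /del_edge_rel hl ?inE ?eqxx ?orbT // eq_sym (negPf (adj_neq pm)).
have degd := deg_del_edgeB _ he0.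
(* The card contains the path with middle [p] and ends [l], [m]; the new edge closes it into a
   triangle, whose vertices are pairwise twins, so its three edges all match. *)
pose H := @add_edge (del_edge e0) l m.
have degH (u : G) : @deg H u = deg u - (u \in e0) + (u \in [set l; m]).
  by rewrite (@deg_add_edge (del_edge e0)) // degd.
have [dp' dl' dm'] : [/\ @deg H p = 2, @deg H l = 2 & @deg H m = 2].
  rewrite !degH dp dl dm pe0 (negPf le0) (negPf me0) !inE !eqxx orbT.
  by rewrite (negPf (adj_neq pl)) (negPf (adj_neq pm)).
have Hlm : @adj H l m by apply: adj_add_edge.
have Hpl : @adj H p l.
  by apply: adj_add_edgeW; apply: (@adj_del_edgeI _ _ _ _ l); rewrite // !inE eqxx orbT.
have Hpm : @adj H p m.
  by apply: adj_add_edgeW; apply: (@adj_del_edgeI _ _ _ _ m); rewrite // !inE eqxx orbT.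
have [Hml Hlp Hmp] : [/\ @adj H m l, @adj H l p & @adj H m p].
  by split; rewrite adj_sym.
have m0 : [set l; m] \in matching_edges (card_of e0) H.
  apply: add_edge_matching => //.
  by rewrite !degd (negPf le0) (negPf me0) dl dm ed0.
have m1 : [set p; m] \in matching_edges (card_of e0) H.
  have := iso_fun_matching (twins_deg2 dl' dp' Hlp Hlm Hpm) m0.
  by rewrite imsetU1 imset_set1 tpermL tpermD // (adj_neq Hlm, adj_neq Hpm).
have m2 : [set l; p] \in matching_edges (card_of e0) H.
  have := iso_fun_matching (twins_deg2 dm' dp' Hmp Hml Hpl) m0.
  by rewrite imsetU1 imset_set1 tpermL tpermD // (adj_neq Hml, adj_neq Hpl).
apply: (is_dern_succ all_eqv e4 (H := H)).
- apply/negP=> isoGH; have [x] := giso_deg (l : H) isoGH; rewrite dl' => dx.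
  by case: (dG x); rewrite dx.
- apply/card_gt2P; exists [set l; m], [set p; m], [set l; p]; split; split=> //.
  + apply/eqP=> /setP/(_ p); rewrite !inE eqxx (negPf (adj_neq pl)).
    by rewrite (negPf (adj_neq pm)).
  + apply/eqP=> /setP/(_ m); rewrite !inE eqxx orbT eq_sym (negPf nlm).
    by rewrite eq_sym (negPf (adj_neq pm)).
  + apply/eqP=> /setP/(_ p); rewrite !inE eqxx orbT (negPf (adj_neq pl)).
    by rewrite (negPf (adj_neq pm)).
move=> K nGK.
have [->|[e1 he1]] := set_0Vmem (matching_edges (card_of e0) K); first by rewrite cards0.
have bad e : e \in matching_edges (card_of e0) K -> exists x y w,
    [/\ @adj K x y, e = [set x; y], deg x = 2, deg y = 2
      & forall z, z \notin e -> deg z = 2 -> z = w].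
  move=> /matching_edgeP[eK [f [hf [x [y [xy E hd]]]]]].
  have df z : @deg K z = @deg (del_edge e0) (f z) + (z \in e).
    by rewrite (deg_del_edge z eK) -(deg_iso_fun (z : del_edge e) hf).
  have d2 z : @deg (del_edge e0) z = 2 -> z = p.
    rewrite degd E0 !inE; case: eqVneq => //= nzp; case: eqVneq => [->|_] /=.
      by rewrite dq.
    by rewrite subn0 => dz; case: (dG z); rewrite dz.
  (* Joining [p] to any isolated vertex of the card gives [G] back, since that vertex can be
     exchanged with [q]. This rules out the sum 0 + 2 and leaves 1 + 1. *)
  have good u v : @adj K u v -> e = [set u; v] -> @deg (del_edge e0) (f u) = 0 ->
      @deg (del_edge e0) (f v) = 2 -> False.
    move=> uv Euv du /d2 fv; case/negP: nGK.
    have dq0 : @deg (del_edge e0) q = 0.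
      by rewrite degd dq E0 !inE eqxx orbT.
    have tw : @iso_fun (del_edge e0) (del_edge e0) (tperm (f u) q).
      by apply: iso_fun_tperm => z _ _; rewrite !deg0_adj.
    rewrite Euv in hf; apply: (matching_edge_giso he0 uv (iso_fun_comp tw hf)) => /=.
      by rewrite tpermL E0 !inE eqxx orbT.
    rewrite fv tpermD //; last by rewrite eq_sym adj_neq.
    by apply/eqP=> fu; move: du; rewrite fu degd dp pe0.
  have [w wp] : exists w, f w = p by case: hf.1 => g _ gK; exists (g p).
  have [dx dy] : @deg (del_edge e0) (f x) = 1 /\ @deg (del_edge e0) (f y) = 1.
    move: hd (good x y xy E) (good y x); rewrite ed0 adj_sym setUC => hd g1 /(_ xy E) g2.
    case: (@deg (del_edge e0) (f x)) hd g1 g2 => [|[|[|]]] //=.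
    - by rewrite add0n => -> /(_ erefl erefl).
    - by case; rewrite add0n => ->.
    - by case; rewrite add0n => -> _ /(_ erefl erefl).
  exists x, y, w; split=> //.
  - by rewrite df dx E !inE eqxx.
  - by rewrite df dy E !inE eqxx orbT.
  move=> z ze; rewrite df (negPf ze) addn0 => /d2 fz.
  by apply: (bij_inj hf.1); rewrite wp.
have [x1 [y1 [w1 [xy1 E1 dx1 dy1 h1]]]] := bad _ he1.
(* Outside [e1] only the preimage [w1] of [p] can have degree 2 in [K]. Matching edges join vertices
   of degree 2, so they are pairs from [D], at most three. *)
pose D := [set w1; x1; y1].
have D3 : #|D| <= 3.
  rewrite /D setUC cardsU1; apply: leq_add (leq_b1 _) _.
  by rewrite cards2; case: (_ != _).
apply: (@leq_trans #|[set A : {set K} | A \subset D & #|A| == 2]|); last first.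
  by rewrite cards_draws; apply: leq_trans (leq_bin2l _ D3) _.
apply/subset_leq_card/subsetP=> e /bad[x [y [w [xy E dx dy _]]]].
have inD z : deg z = 2 -> z \in D.
  move=> dz; rewrite !inE; case: (boolP (z \in e1)).
    by rewrite E1 !inE => /orP[]->; rewrite ?orbT.
  by move=> ze; rewrite (h1 z ze dz) eqxx.
rewrite inE E cards2 adj_neq // andbT; apply/subsetP=> z.
by rewrite !(inE, in_set2) => /orP[]/eqP->; have := inD x dx; have := inD y dy; rewrite !inE.
Qed.

Lemma dern_triangles_claws (G : sgraph) (a b : G) :
    (forall x : G, tri_vertex x \/ star_vertex 3 x) ->
    tri_vertex a -> star_vertex 3 b ->
  is_dern G 2.
Proof.
move=> hG ha hb.
have hG3 (x : G) : [\/ deg x = 0, tri_vertex x | star_vertex 3 x].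
  by case: (hG x); [constructor 2 | constructor 3].
have dG (x : G) : [\/ deg x = 1, deg x = 2 | deg x = 3].
  by case: (hG x) => [[]|/star_vertex_deg[]]; [constructor 2|constructor 3|constructor 1].
have d3 (x y : G) : deg x = 3 -> adj x y -> deg y = 1.
  move=> dx xy; case: (hG x) => [[]|hx]; first by rewrite dx.
  by have [_ ->] := star_vertex_center hx dx isT.
have d1 (x : G) : deg x = 1 -> exists2 c, adj c x & deg c = 3.
  move=> dx; case: (hG x) => [[]|[[]|[c [dc _] cx]]]; rewrite ?dx //.
  by exists c.
split; last first.
  move=> j; apply: (determined_by_gt1 a) => e he; case/edgesP: (he) => x [y [xy E]].
  case: (hG x) => [hx|/star_vertex_edge/(_ xy)[p [q [hp pq]]]]; last first.
    rewrite -E => {}E; have [l [m [us hpN hl]]] := star_center_claw hp pq.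
    have pl : adj p l by rewrite hpN !inE eqxx orbT.
    have pm : adj p m by rewrite hpN !inE eqxx !orbT.
    have [dp dleaf] := hp.
    have [dq dl dm] := And3 (dleaf _ pq) (dleaf _ pl) (dleaf _ pm).
    have [nql nqm nlm] : [/\ q != l, q != m & l != m].
      by move: us; rewrite /= !inE !negb_or => /and4P[_ /andP[-> ->] -> _].
    have le : l \notin e by rewrite E !inE negb_or ![l == _]eq_sym adj_neq.
    have me : m \notin e by rewrite E !inE negb_or ![m == _]eq_sym adj_neq.
    have nlm' : ~~ @adj (del_edge e) l m.
      by rewrite /= /del_edge_rel hl ?inE ?eqxx ?orbT // eq_sym (negPf (adj_neq pm)).
    (* Here [e] is a claw edge; its leaf [q] is left isolated, while [G] has no isolated vertex. *)
    exists (@add_edge (del_edge e) l m).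
      apply/negP=> iso; have [z] := giso_deg (q : @add_edge (del_edge e) l m) iso.
      rewrite (@deg_add_edge (del_edge e)) // deg_del_edgeB // dq E !inE eqxx orbT.
      by rewrite (negPf nql) (negPf nqm) => dz; case: (dG z); rewrite dz.
    apply/card_gt0P; exists [set l; m]; apply: add_edge_matching => //.
    by rewrite !deg_del_edgeB // dl dm (negPf le) (negPf me) E edge_deg_set2 // dp dq.
  have dx : deg x = 2 by case: hx.
  have dy : deg y = 2 := tri_vertex_nbr hG3 hx xy.
  have e2 z : deg z != 2 -> z \notin e.
    by apply: contra; rewrite E !inE => /orP[]/eqP->; rewrite ?dx ?dy.
  have [c hc] : exists c : G, star_center 3 c by case: hb => [|[c]]; [exists b|exists c].
  have [dc dleaf] := hc.
  have [k ck] : exists k, adj c k by apply: deg_neq0; rewrite dc.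
  have [l [m [us hpN hl]]] := star_center_claw hc ck.
  have cl : adj c l by rewrite hpN !inE eqxx orbT.
  have cm : adj c m by rewrite hpN !inE eqxx !orbT.
  have [dl dm] : deg l = 1 /\ deg m = 1 by split; apply: dleaf.
  have nlm : l != m.
    by move: us; rewrite /= !inE !negb_or => /and4P[_ /andP[_ _] -> _].
  have [le me ce] : [/\ l \notin e, m \notin e & c \notin e].
    by split; apply: e2; rewrite ?dl ?dm ?dc.
  have nlm' : ~~ @adj (del_edge e) l m.
    by rewrite /= /del_edge_rel hl ?inE ?eqxx ?orbT // eq_sym (negPf (adj_neq cm)).
  (* Here [e] is a triangle edge and the claw at [c] is intact. In [H] the vertex [c] of degree 3
     gets a neighbour of degree 2, while in [G] neighbours of vertices of degree 3 are leaves. *)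
  pose H := @add_edge (del_edge e) l m.
  have dlH : @deg H l = 2.
    by rewrite (@deg_add_edge (del_edge e)) // deg_del_edgeB // dl (negPf le) !inE eqxx.
  have dcH : @deg H c = 3.
    rewrite (@deg_add_edge (del_edge e)) // deg_del_edgeB // dc (negPf ce) !inE.
    by rewrite (negPf (adj_neq cl)) (negPf (adj_neq cm)).
  have clH : @adj H c l.
    by apply: adj_add_edgeW; apply: (@adj_del_edgeI _ _ _ _ c); rewrite // !inE eqxx.
  exists H.
    rewrite giso_sym; apply/negP=> /giso_iso_fun[f hf].
    have := d3 (f c) (f l); rewrite !(deg_iso_fun _ hf) dcH dlH hf.2 => /(_ erefl clH).
    by [].
  apply/card_gt0P; exists [set l; m]; apply: add_edge_matching => //.
  by rewrite !deg_del_edgeB // dl dm (negPf le) (negPf me) E edge_deg_set2 // dx dy.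
have [q pq] : exists q, adj a q by apply: deg_neq0; rewrite (proj1 ha).
have [r htri] := tri_vertex_edge hG3 ha pq.
have dp : deg a = 2 by case: ha.
have dq : deg q = 2 := tri_vertex_nbr hG3 ha pq.
pose e0 := [set a; q]; have he0 : e0 \in edges G := mem_edges pq.
have ed0 : edge_deg e0 = 2 by rewrite edge_deg_set2 // dp dq.
have e02 z : z \in e0 -> deg z = 2 by rewrite !inE => /orP[]/eqP->.
have degd := deg_del_edgeB _ he0.
(* Without isolated vertices in the card, the sum 2 can only be 1 + 1, so matching edges join
   vertices of degree 2. *)
have degd_gt0 z : 0 < @deg (del_edge e0) z.
  rewrite degd; case: (boolP (z \in e0)) => [/e02->//|_].
  by rewrite subn0; case: (dG z) => ->.
(* Adding to this card an edge other than [e0] creates the pair excluded here. *)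
have no23 (z w : G) : @adj (del_edge e0) z w -> @deg (del_edge e0) z = 3 ->
    @deg (del_edge e0) w = 2 -> False.
  move=> /andP[zw _]; rewrite !degd => dz dw.
  have dz3 : deg z = 3 by case: (dG z) dz => ->; case: (z \in e0).
  by move: dw; rewrite (d3 _ _ dz3 zw); case: (w \in e0).
apply: (@determined_by_nseq _ (card_of e0)).
  have ar : adj a r by case: htri => _ _ ->; rewrite inE eqxx.
  have [r' htri'] := tri_vertex_edge hG3 ha ar.
  have [f hf Ef] := triangle_automorphism htri htri'.
  apply/card_gt1P; exists e0, [set a; r]; split; first exact: self_matching.
    by rewrite -Ef; apply: iso_fun_matching => //; apply: self_matching.
  apply/eqP=> /set2_inj E; case: htri => + _ _ _.
  by rewrite /= !inE E eqxx orbT.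
move=> H /card_gt1P[e1 [e2 [m1 m2 ne]]]; apply: contraT => nGH.
have match2 e : e \in matching_edges (card_of e0) H -> {in e, forall z, deg z = 2}.
  move=> /matching_edgeP[eK [f [hf [x [y [xy E hd]]]]]] z ze.
  rewrite (deg_del_edge z eK) -(deg_iso_fun (z : del_edge e) hf) ze.
  move: hd (degd_gt0 (f x)) (degd_gt0 (f y)); rewrite ed0.
  case dfx: (@deg (del_edge e0) (f x)) => [|[|[|]]] //;
    case dfy: (@deg (del_edge e0) (f y)) => [|[|[|]]] // _ _ _.
  by move: ze; rewrite E !inE => /orP[]/eqP->; rewrite ?dfx ?dfy.
(* Some end of [e] is mapped outside [e0]. It has degree 1 in the card, so it is a leaf of a claw,
   whose centre keeps degree 3. *)
have claim e : e \in matching_edges (card_of e0) H -> exists x y c,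
    [/\ e = [set x; y], adj x y, adj c x, c \notin e & deg c = 3].
  move=> me; have m2e := match2 _ me.
  case/matching_edgeP: me => eK [f [hf [u [v [uv E hd]]]]].
  have [x [y [xy Exy fx]]] : exists x y, [/\ adj x y, e = [set x; y] & f x \notin e0].
    case: (boolP (f u \in e0)) => fu; last by exists u, v.
    case: (boolP (f v \in e0)) => fv; last by exists v, u; rewrite adj_sym setUC.
    by case/negP: nGH; rewrite E in hf; apply: (matching_edge_giso he0 uv hf).
  have xe : x \in e by rewrite Exy !inE eqxx.
  have dfx : deg (f x) = 1.
    have := m2e x xe; rewrite (deg_del_edge x eK) -(deg_iso_fun (x : del_edge e) hf).
    by rewrite xe degd (negPf fx) subn0 addn1 => -[].
  have [c cx dc] := d1 _ dfx.
  have ce0 : c \notin e0 by apply/negP=> /e02; rewrite dc.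
  have [g fK gK] := hf.1.
  have cx' : @adj (del_edge e) (g c) x.
    by rewrite -hf.2 gK; apply: (@adj_del_edgeI _ _ _ _ c); rewrite // !inE eqxx.
  have dgc : @deg (del_edge e) (g c) = 3.
    by rewrite -(deg_iso_fun _ hf) gK degd dc (negPf ce0).
  have gce : g c \notin e.
    by apply/negP=> gce; have := m2e _ gce; rewrite (deg_del_edge _ eK) dgc gce.
  exists x, y, (g c); split=> //; first by case/andP: cx'.
  by rewrite (deg_del_edge _ eK) dgc (negPf gce).
have [x [y [c [E1 xy cx ce1 dc]]]] := claim _ m1.
have xe1 : x \in e1 by rewrite E1 !inE eqxx.
have dx := match2 _ m1 x xe1.
have ce2 : c \notin e2 by apply/negP=> /(match2 _ m2); rewrite dc.
have [e2H [f [hf _]]] := matching_edgeP m2.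
(* Otherwise [c] and [x] would stay adjacent, with degrees 3 and 2, after the deletion of [e2]. *)
have xe2 : x \in e2.
  apply/negPn/negP=> xe2; apply: (no23 (f c) (f x)).
  - by rewrite hf.2; apply: (@adj_del_edgeI _ _ _ _ c); rewrite // !inE eqxx.
  - by rewrite (deg_iso_fun _ hf) deg_del_edgeB // dc (negPf ce2).
  - by rewrite (deg_iso_fun _ hf) deg_del_edgeB // dx (negPf xe2).
have [z xz E2] := edge_at e2H xe2.
(* The edge [e2] contains [x] and avoids [c], which has degree 3, so it must be [e1]. *)
have xN : forall z, adj x z = (z \in [:: c; y]).
  apply: nbhd_seq => //; last by rewrite /= xy adj_sym cx.
  rewrite /= inE andbT; apply: contraNneq ce1 => ->.
  by rewrite E1 !inE eqxx orbT.
move: xz; rewrite xN !inE => /orP[]/eqP Ez.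
  by move: ce2; rewrite E2 Ez !inE eqxx orbT.
by rewrite E1 E2 Ez eqxx in ne.
Qed.

(** * From components to conditions on vertices *)

Lemma edges_gt3 (G : sgraph) (C : {set G}) (y : G) :
    3 <= #|edges (induced C)| -> deg y != 0 -> y \notin C ->
  3 < #|edges G|.
Proof.
move=> hC /deg_neq0[z yz] yC.
(* The edges inside [C], seen in [G]; an edge at [y], outside [C], is the fourth. *)
pose A := [set [set val x | x in (e : {set induced C})] | e in edges (induced C)].
have cA : #|A| = #|edges (induced C)| by apply: card_imset; apply: imset_inj val_inj.
apply: (@leq_trans #|[set y; z] |: A|).
  rewrite cardsU1 cA; suff -> : [set y; z] \notin A by rewrite add1n ltnS.
  apply/imsetP=> -[e _ /setP/(_ y)]; rewrite !inE eqxx => /esym/imsetP[u _ Eu].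
  by case/negP: yC; rewrite Eu (valP u).
apply/subset_leq_card/subsetP=> e /setU1P[->|/imsetP[d /edgesP[u [v [uv ->]]] ->]].
  exact: mem_edges.
by rewrite imsetU1 imset_set1; apply: mem_edges.
Qed.

Theorem theorem4p1 (G : sgraph)
  (hdisc : disconnected G)
  (hnontriv : 2 <= #|[set C in components G | nontrivial C]|)
  (hedges : forall C : {set G}, C \in components G -> nontrivial C ->
     3 <= #|edges (induced C)|) :
  [/\ (forall C : {set G}, C \in components G -> giso (induced C) (complete 3)) ->
        is_dern G 1,
      (forall C : {set G}, C \in components G -> giso (induced C) (star 3)) ->
        is_dern G 4,
      forall t : nat, 3 < t ->
        (forall C : {set G}, C \in components G -> giso (induced C) (star t)) ->
        is_dern G 1,
      [/\ forall C : {set G}, C \in components G ->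
            giso (induced C) (complete 3) \/ giso (induced C) (star 3),
          exists2 C : {set G}, C \in components G & giso (induced C) (complete 3)
        & exists2 C : {set G}, C \in components G & giso (induced C) (star 3)] ->
        is_dern G 2
    & ((forall C : {set G}, C \in components G -> nontrivial C ->
          giso (induced C) (complete 3)) /\ (exists x : G, isolated x))
      \/
      ((forall C : {set G}, C \in components G -> nontrivial C ->
          giso (induced C) (star 3)) /\ (exists x : G, isolated x)) ->
        is_dern G 4].
Proof.
have compI (x : G) : [set y | connect (@adj G) x y] \in components G.
  exact: imset_f.
have [x0 [y0 [nt0 dy0 nxy0]]] := two_nontrivial_components hnontriv.
(* Guarantees the four copies of a card needed where the value is 4. *)
have e4 : 3 < #|edges G|.
  by apply: edges_gt3 (hedges _ (compI x0) nt0) dy0 _; rewrite inE.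
split.
- by move=> h; apply: (dern_triangles x0) => x; apply/component_tri_vertex/h.
- by move=> h; apply: dern_claws => // x; right; apply/component_star_vertex/h.
- by move=> t t3 h; apply: (dern_stars x0 t3) => x; apply/component_star_vertex/h.
- case=> h [_ /imsetP[a _ ->] ha] [_ /imsetP[b _ ->] hb].
  apply: (@dern_triangles_claws G a b).
  + move=> x; case: (h _ (compI x)) => [/component_tri_vertex|/component_star_vertex]; by auto.
  + exact: component_tri_vertex.
  + exact: component_star_vertex.
case=> -[h [i /eqP di]].
  apply: (dern_triangles_isolated _ di) => // x.
  case: (boolP (nontrivial [set y | connect (@adj G) x y])) => nt.
    by right; apply/component_tri_vertex/h.
  by left; apply: component_isolated.
apply: dern_claws => // x.
case: (boolP (nontrivial [set y | connect (@adj G) x y])) => nt.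
  by right; apply/component_star_vertex/h.
by left; apply: component_isolated.
Qed.
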